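(* Let $Q$ be a quiver, let $$P_{lin} = \sum_{\substack{a,b,c\in Q_1\\ a\frac{\partial}{\partial b}\frac{\partial}{\partial c}\neq 0\in\mathfrak{n}_Q}} c^a_{bc}\,a\frac{\partial}{\partial b}\frac{\partial}{\partial c}\qquad(c_{bc}^a\in\mathbb{C})$$ be a linear double Poisson bracket on $\mathbb{C}Q$, and let $v$ be a vertex of $Q$. Then $P_{lin}$ induces an associative algebra structure on the vector space $V_v$ generated by all loops in $v$; namely, the product on $V_v$ with structure constants $c_{bc}^a$, i.e. $b\cdot c:=\sum_{a}c_{bc}^a\,a$ for loops $b,c$ in $v$ (sum over all loops $a$ in $v$), is associative.
   Context: $\mathbb{C}$ is an algebraically closed field of characteristic $0$; $Q$ is a finite quiver with arrows $Q_1$; $t(a)$, $h(a)$ are tail and head; paths are multiplied so that $a=e_{t(a)}ae_{h(a)}$. A loop in $v$ is an arrow with tail and head $v$. Associative algebras need not be unital here. Let $A=\mathbb{C}Q$. The outer bimodule structure on $A\otimes A$ is $a.(a'\otimes a'').b=aa'\otimes a''b$. A double bracket on $A$ is a linear map $\{\!\!\{-,-\}\!\!\}:A\otimes A\to A\otimes A$, derivation in its second argument for the outer structure, with $\{\!\!\{a,b\}\!\!\}=-\{\!\!\{b,a\}\!\!\}^o$, $(u\otimes v)^o=v\otimes u$. It is a double Poisson bracket if for all $a,b,c$ $$\{\!\!\{a,\{\!\!\{b,c\}\!\!\}'\}\!\!\}\otimes\{\!\!\{b,c\}\!\!\}''+\{\!\!\{c,a\}\!\!\}''\otimes\{\!\!\{b,\{\!\!\{c,a\}\!\!\}'\}\!\!\}+\{\!\!\{c,\{\!\!\{a,b\}\!\!\}'\}\!\!\}''\otimes\{\!\!\{a,b\}\!\!\}''\otimes\{\!\!\{c,\{\!\!\{a,b\}\!\!\}'\}\!\!\}'=0.$$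 For $a\in Q_1$, $\frac{\partial}{\partial a}:A\to A\otimes A$ is the derivation (outer structure), vanishing on vertex idempotents, with $\frac{\partial}{\partial a}(a)=e_{t(a)}\otimes e_{h(a)}$ and $\frac{\partial}{\partial a}(b)=0$ for arrows $b\ne a$. Double derivations form an $A$-bimodule by $(a\delta b)(c)=\delta(c)'b\otimes a\delta(c)''$. A product $\delta\Delta$ of double derivations determines the double bracket $\{\!\!\{a,b\}\!\!\}_{\delta\Delta}=(\delta(a)'\Delta\delta(a)'')(b)-(\Delta(a)'\delta\Delta(a)'')(b)$, extended linearly. A linear double bracket is one determined by a tensor of the form $P_{lin}$; it is a linear double Poisson bracket if it is a double Poisson bracket. The double quiver $\overline{Q}$ adds for each $a\in Q_1$ an arrow $a^*$ from $h(a)$ to $t(a)$, identified with $\frac{\partial}{\partial a}$; $\mathfrak{n}_Q$ is $\mathbb{C}\overline{Q}$ modulo supercommutators (with $|a|=0$, $|a^*|=1$). Thus $a\frac{\partial}{\partial b}\frac{\partial}{\partial c}\ne0$ in $\mathfrak{n}_Q$ means that $ab^*c^*$ is a closed path in $\overline{Q}$. *)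

(* Defs.v *)
From HB Require Import structures.
From mathcomp Require Import all_boot all_order all_algebra.
From mathcomp Require Import finmap boolp monalg.

Set Implicit Arguments.
Unset Strict Implicit.
Unset Printing Implicit Defensive.

Import GRing.Theory.
Import Quotient.
Local Open Scope quotient_scope.
Local Open Scope ring_scope.

(* [{malg C[K]}] is the vector space with basis the [bvec k], for [k : K];
   [lext] and [lext2] extend maps on bases linearly and bilinearly.
   They are locked because conversion tests that unfold them diverge. *)
HB.lock Definition bvec (C : fieldType) (K : choiceType) (k : K) : {malg C[K]} :=
  << k >>.

HB.lock Definition lext (C : fieldType) (K : choiceType) (V : lmodType C)
    (f : K -> V) (w : {malg C[K]}) : V :=
  \sum_(k <- msupp w) w@_k *: f k.

HB.lock Definition lext2 (C : fieldType) (K L : choiceType) (V : lmodType C)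
    (f : K -> L -> V) (x : {malg C[K]}) (y : {malg C[L]}) : V :=
  \sum_(k <- msupp x) \sum_(l <- msupp y) (x@_k * y@_l) *: f k l.

Arguments bvec C {K} k.

Section LinearExtension.
Variables (C : fieldType) (K : choiceType) (V W : lmodType C).
Implicit Type f : K -> V.

Lemma lextE f (D : {fset K}) w :
  (msupp w `<=` D)%fset -> lext f w = \sum_(k <- D) w@_k *: f k.
Proof.
move=> sD; rewrite lext.unlock (big_fset_incl _ sD) //= => k _ /mcoeff_outdom ->.
by rewrite scale0r.
Qed.

Lemma lext_is_linear f : linear (lext f).
Proof.
move=> a x y; pose D := (msupp x `|` msupp y)%fset.
have sx : (msupp x `<=` D)%fset by exact: fsubsetUl.
have sy : (msupp y `<=` D)%fset by exact: fsubsetUr.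
have sxy : (msupp (a *: x + y) `<=` D)%fset.
  apply: (fsubset_trans (msuppD_le _ _)).
  exact: (fsetUSS (msuppZ_le _ _) (fsubset_refl _)).
rewrite (lextE _ sx) (lextE _ sy) (lextE _ sxy) scaler_sumr -big_split /=.
by apply: eq_bigr => k _; rewrite mcoeffD mcoeffZ scalerDl scalerA.
Qed.

HB.instance Definition _ f :=
  GRing.isLinear.Build C {malg C[K]} V *:%R (lext f) (lext_is_linear f).

Lemma lextU f k : lext f (bvec C k) = f k.
Proof. by rewrite bvec.unlock (lextE _ msuppU_le) big_seq_fset1 mcoeffUU scale1r. Qed.

Lemma eq_lext f g : f =1 g -> lext f =1 lext g.
Proof. by move=> fg w; rewrite lext.unlock; apply: eq_bigr => k _; rewrite fg. Qed.

Lemma linear_lext (h : {linear V -> W}) f w :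
  h (lext f w) = \sum_(k <- msupp w) w@_k *: h (f k).
Proof. by rewrite lext.unlock linear_sum; apply: eq_bigr => k _; rewrite linearZ. Qed.

End LinearExtension.

Section BilinearExtension.
Variables (C : fieldType) (K L : choiceType) (V : lmodType C).
Implicit Type f : K -> L -> V.

Lemma lext2E f x y : lext2 f x y = lext (fun k => lext (f k) y) x.
Proof.
rewrite lext2.unlock lext.unlock; apply: eq_bigr => k _; rewrite scaler_sumr.
by apply: eq_bigr => l _; rewrite scalerA.
Qed.

Lemma lext2Er f x y : lext2 f x y = lext (fun l => lext (f^~ l) x) y.
Proof.
rewrite lext2.unlock lext.unlock exchange_big /=; apply: eq_bigr => l _.
rewrite scaler_sumr.
by apply: eq_bigr => k _; rewrite scalerA mulrC.
Qed.

Lemma lext2_linearl f y : linear ((lext2 f)^~ y).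
Proof. by move=> a u v; rewrite !lext2E linearP. Qed.

Lemma lext2_linearr f x : linear (lext2 f x).
Proof. by move=> a u v; rewrite !lext2Er linearP. Qed.

Lemma lext20l f y : lext2 f 0 y = 0. Proof. by rewrite lext2E linear0. Qed.

Lemma lext20r f x : lext2 f x 0 = 0. Proof. by rewrite lext2Er linear0. Qed.

Lemma lext2UU f k l : lext2 f (bvec C k) (bvec C l) = f k l.
Proof. by rewrite lext2E !lextU. Qed.

End BilinearExtension.

Lemma linear_basisP (C : fieldType) (K : choiceType) (V : lmodType C)
    (f g : {malg C[K]} -> V) :
  linear f -> linear g -> (forall k, f (bvec C k) = g (bvec C k)) -> f =1 g.
Proof.
move=> lf lg fg w; rewrite (monalgE w).
pose F := GRing.isLinear.Build C {malg C[K]} V *:%R f lf.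
pose G := GRing.isLinear.Build C {malg C[K]} V *:%R g lg.
pose f' : {linear {malg C[K]} -> V} := HB.pack f F.
pose g' : {linear {malg C[K]} -> V} := HB.pack g G.
rewrite -[f]/(f' : _ -> _) -[g]/(g' : _ -> _) !linear_sum.
apply: eq_bigr => k _.
have -> : << w@_k *g k >> = w@_k *: bvec C k.
  by rewrite bvec.unlock; apply/malgP => l; rewrite mcoeffZ !mcoeffU mulrnAr mulr1.
by rewrite !linearZ /= fg.
Qed.

Record quiver := Quiver {
  vert : finType; arr : finType; tl : arr -> vert; hd : arr -> vert }.

Section Paths.
Variable Q : quiver.

Fixpoint walk (v : vert Q) (s : seq (arr Q)) : bool :=
  if s is a :: s' then (tl a == v) && walk (hd a) s' else true.

Definition wend (v : vert Q) (s : seq (arr Q)) : vert Q := last v (map (@hd Q) s).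

Record qpath := QPath {
  pval : vert Q * seq (arr Q); pvalP : walk pval.1 pval.2 }.

HB.instance Definition _ := [isSub for pval].
HB.instance Definition _ := [Countable of qpath by <:].

Definition psrc (p : qpath) := (pval p).1.
Definition pseq (p : qpath) := (pval p).2.
Definition ptgt (p : qpath) := wend (psrc p) (pseq p).

Lemma walk_cat v s1 s2 : walk v (s1 ++ s2) = walk v s1 && walk (wend v s1) s2.
Proof. by elim: s1 v => //= a s1 IH v; rewrite IH andbA. Qed.

Lemma wend_cat v s1 s2 : wend v (s1 ++ s2) = wend (wend v s1) s2.
Proof. by rewrite /wend map_cat last_cat. Qed.

Lemma walk_nth v s a i : walk v s -> (i < size s)%N -> nth a s i = a ->
  [/\ walk v (take i s), wend v (take i s) = tl a,
      walk (hd a) (drop i.+1 s) & wend (hd a) (drop i.+1 s) = wend v s].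
Proof.
move=> ws lti nia.
have e : s = take i s ++ a :: drop i.+1 s by rewrite -{1}nia -drop_nth ?cat_take_drop.
move: ws; rewrite {1}e walk_cat /= => /and3P[-> /eqP-> ->]; split=> //.
by rewrite [in RHS]e wend_cat.
Qed.

End Paths.

Definition pathalg (C : fieldType) (Q : quiver) := {malg C[qpath Q]}.

Section PathAlgebra.
Variables (C : fieldType) (Q : quiver).
Local Notation A := (pathalg C Q).

HB.instance Definition _ := GRing.Lmodule.on A.

Definition pbase (p : qpath Q) : A := bvec C p.

(* The path starting at [x.1] with arrows [x.2], and 0 if these do not compose. *)
Definition wpath (x : vert Q * seq (arr Q)) : A :=
  if insub x is Some p then pbase p else 0.

Definition path_mul (p q : qpath Q) : A :=
  if ptgt p == psrc q then wpath (psrc p, pseq p ++ pseq q) else 0.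

Definition pa_mul : A -> A -> A := lext2 path_mul.

Definition evert (v : vert Q) : A := wpath (v, [::]).
Definition earr (a : arr Q) : A := wpath (tl a, [:: a]).

Definition pa_one : A := \sum_v evert v.

Lemma wpath_pval p : wpath (pval p) = pbase p.
Proof. by rewrite /wpath valK. Qed.

Lemma wpathE v s (h : walk v s) : wpath (v, s) = pbase (@QPath Q (v, s) h).
Proof. exact: (wpath_pval (@QPath Q (v, s) h)). Qed.

Lemma wpath0 v s : ~~ walk v s -> wpath (v, s) = 0.
Proof. by move=> h; rewrite /wpath insubN. Qed.

Lemma pa_mulUU p q : pa_mul (pbase p) (pbase q) = path_mul p q.
Proof. exact: lext2UU. Qed.

Lemma pa_mul0l y : pa_mul 0 y = 0. Proof. exact: lext20l. Qed.

Lemma pa_mul0r x : pa_mul x 0 = 0. Proof. exact: lext20r. Qed.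

Lemma pa_mul_wpath v s w t : pa_mul (wpath (v, s)) (wpath (w, t)) =
  if walk v s && walk w t && (wend v s == w) then wpath (v, s ++ t) else 0.
Proof.
have [hs|hs] := boolP (walk v s); last first.
  by rewrite (wpath0 hs) pa_mul0l.
have [ht|ht] := boolP (walk w t); last first.
  by rewrite (wpath0 ht) pa_mul0r andbF.
by rewrite (wpathE hs) (wpathE ht) pa_mulUU.
Qed.

Lemma pa_mul_linearl y : linear (pa_mul^~ y). Proof. exact: lext2_linearl. Qed.

Lemma pa_mul_linearr x : linear (pa_mul x). Proof. exact: lext2_linearr. Qed.

Lemma pa_suml (I : finType) (F : I -> A) y :
  pa_mul (\sum_i F i) y = \sum_i pa_mul (F i) y.
Proof.
by rewrite /pa_mul lext2E linear_sum; apply: eq_bigr => i _; rewrite lext2E.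
Qed.

Lemma pa_sumr (I : finType) (F : I -> A) x :
  pa_mul x (\sum_i F i) = \sum_i pa_mul x (F i).
Proof.
by rewrite /pa_mul lext2Er linear_sum; apply: eq_bigr => i _; rewrite lext2Er.
Qed.

Lemma pa_mulA : associative pa_mul.
Proof.
move=> x y z.
apply: (linear_basisP (f := fun x => pa_mul x (pa_mul y z))
  (g := fun x => pa_mul (pa_mul x y) z)) x => [a u v|a u v|p].
- by rewrite (pa_mul_linearl _ a u v).
- by rewrite (pa_mul_linearl y a u v) (pa_mul_linearl z).
apply: (linear_basisP (f := fun y => pa_mul (pbase p) (pa_mul y z))
  (g := fun y => pa_mul (pa_mul (pbase p) y) z)) y => [a u v|a u v|q].
- by rewrite (pa_mul_linearl z a u v) (pa_mul_linearr (pbase p)).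
- by rewrite (pa_mul_linearr (pbase p) a u v) (pa_mul_linearl z).
apply: (linear_basisP (f := fun z => pa_mul (pbase p) (pa_mul (pbase q) z))
  (g := fun z => pa_mul (pa_mul (pbase p) (pbase q)) z)) z => [a u v|a u v|r].
- by rewrite (pa_mul_linearr (pbase q) a u v) (pa_mul_linearr (pbase p)).
- by rewrite (pa_mul_linearr _ a u v).
rewrite -/(pbase r) -!wpath_pval.
move: (pvalP p) (pvalP q) (pvalP r).
case: (pval p) => v s; case: (pval q) => w t; case: (pval r) => u k /= hs ht hr.
rewrite !pa_mul_wpath hs ht hr /=.
have [wu|wu] := eqVneq (wend w t) u; have [vw|vw] := eqVneq (wend v s) w.
- rewrite !pa_mul_wpath !walk_cat hs vw ht wu hr eqxx wend_cat vw wu eqxx /=.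
  by rewrite catA.
- by rewrite pa_mul_wpath (negPf vw) andbF pa_mul0l.
- by rewrite pa_mul_wpath wend_cat vw (negPf wu) andbF pa_mul0r.
- by rewrite pa_mul0l pa_mul0r.
Qed.

Lemma pa_mul1l : left_id pa_one pa_mul.
Proof.
move=> x; apply: (linear_basisP (f := pa_mul pa_one) (g := id)) x => [||p] //.
  exact: pa_mul_linearr.
rewrite -/(pbase p) /pa_one pa_suml -wpath_pval.
move: (pvalP p); case: (pval p) => v s /= hs.
rewrite (bigD1 v) //= big1 => [|w wv].
  by rewrite pa_mul_wpath hs eqxx addr0.
by rewrite pa_mul_wpath hs /= /wend /= (negPf wv).
Qed.

Lemma pa_mul1r : right_id pa_one pa_mul.
Proof.
move=> x; apply: (linear_basisP (f := pa_mul^~ pa_one) (g := id)) x => [||p] //.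
  exact: pa_mul_linearl.
rewrite -/(pbase p) /pa_one pa_sumr -wpath_pval.
move: (pvalP p); case: (pval p) => v s /= hs.
rewrite (bigD1 (wend v s)) //= big1 => [|w wv].
  by rewrite pa_mul_wpath hs eqxx addr0 cats0.
by rewrite pa_mul_wpath hs /= eq_sym (negPf wv).
Qed.

Lemma pa_mulDl : left_distributive pa_mul +%R.
Proof. by move=> x y z; rewrite /pa_mul !lext2E linearD. Qed.

Lemma pa_mulDr : right_distributive pa_mul +%R.
Proof. by move=> x y z; rewrite /pa_mul !lext2Er linearD. Qed.

(* Only a [pzRingType]: the path algebra of the empty quiver is zero. *)
HB.instance Definition _ :=
  GRing.Zmodule_isPzRing.Build A pa_mulA pa_mul1l pa_mul1r pa_mulDl pa_mulDr.

Lemma pa_scaleAl (k : C) (x y : A) : k *: (x * y) = (k *: x) * y.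
Proof.
by rewrite -[LHS]/(k *: lext2 _ x y) -[RHS]/(lext2 _ (k *: x) y) !lext2E linearZ.
Qed.

Lemma pa_scaleAr (k : C) (x y : A) : k *: (x * y) = x * (k *: y).
Proof.
by rewrite -[LHS]/(k *: lext2 _ x y) -[RHS]/(lext2 _ x (k *: y)) !lext2Er linearZ.
Qed.

Lemma mul_wpath v s w t : wpath (v, s) * wpath (w, t) =
  if walk v s && walk w t && (wend v s == w) then wpath (v, s ++ t) else 0.
Proof. exact: pa_mul_wpath. Qed.

End PathAlgebra.

Arguments evert C {Q} v.
Arguments earr C {Q} a.
Arguments wpath C {Q} x.
Arguments pbase C {Q} p.

(* The tensor powers of a path algebra, with the basis of tuples of paths. *)
Definition tensor2 (C : fieldType) (Q : quiver) := {malg C[(qpath Q * qpath Q)%type]}.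
Definition tensor3 (C : fieldType) (Q : quiver) :=
  {malg C[(qpath Q * qpath Q * qpath Q)%type]}.

Section DoubleBrackets.
Variables (C : fieldType) (Q : quiver).
Local Notation A := (pathalg C Q).
Local Notation A2 := (tensor2 C Q).
Local Notation A3 := (tensor3 C Q).

HB.instance Definition _ := GRing.Lmodule.on A2.
HB.instance Definition _ := GRing.Lmodule.on A3.

Definition tens : A -> A -> A2 := lext2 (fun p q => bvec C (p, q)).

(* For bilinear [f], [sweedler f w] is "f(w', w'')". *)
Definition sweedler (V : lmodType C) (f : A -> A -> V) (w : A2) : V :=
  lext (fun pq => f (pbase C pq.1) (pbase C pq.2)) w.

Definition tens3 (x y z : A) : A3 :=
  lext2 (fun pq r => bvec C (pq, r)) (tens x y) z.

Definition flip (w : A2) : A2 := sweedler (fun u v => tens v u) w.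

Definition outer (a : A) (w : A2) (b : A) : A2 :=
  sweedler (fun u v => tens (a * u) (v * b)) w.

Definition double_derivation (d : A -> A2) : Prop :=
  linear d /\ forall x y, d (x * y) = outer x (d y) 1 + outer 1 (d x) y.

Definition double_bracket (br : A -> A -> A2) : Prop :=
  [/\ forall y, linear (br^~ y), forall x, double_derivation (br x) &
      forall x y, br x y = - flip (br y x)].

Definition double_jacobi (br : A -> A -> A2) : Prop := forall a b c : A,
    sweedler (fun x y => sweedler (fun u v => tens3 u v y) (br a x)) (br b c)
  + sweedler (fun x y => sweedler (fun u v => tens3 y u v) (br b x)) (br c a)
  + sweedler (fun x y => sweedler (fun u v => tens3 v y u) (br c x)) (br a b)
  = 0.

Definition double_poisson (br : A -> A -> A2) : Prop :=
  double_bracket br /\ double_jacobi br.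

(* The sum of p' (x) p'' over the factorizations p = p' a p''. *)
Definition ddiff_path (a : arr Q) (p : qpath Q) : A2 :=
  \sum_(0 <= i < size (pseq p) | nth a (pseq p) i == a)
    tens (wpath C (psrc p, take i (pseq p)))
         (wpath C (hd a, drop i.+1 (pseq p))).

Definition ddiff (a : arr Q) : A -> A2 := lext (ddiff_path a).

Definition bimod (a : A) (d : A -> A2) (b : A) : A -> A2 :=
  fun c => sweedler (fun u v => tens (u * b) (a * v)) (d c).

Definition product_bracket (d D : A -> A2) (a b : A) : A2 :=
  sweedler (fun u v => bimod u D v b) (d a)
  - sweedler (fun u v => bimod u d v b) (D a).

Lemma tensUU p q : tens (pbase C p) (pbase C q) = bvec C (p, q).
Proof. exact: lext2UU. Qed.

Lemma tens_linearl y : linear (tens^~ y). Proof. exact: lext2_linearl. Qed.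

Lemma tens_linearr x : linear (tens x). Proof. exact: lext2_linearr. Qed.

Lemma tens0l y : tens 0 y = 0. Proof. exact: lext20l. Qed.

Lemma tens0r x : tens x 0 = 0. Proof. exact: lext20r. Qed.

Lemma sweedler_tens (V : lmodType C) (f : A -> A -> V) x y :
  (forall v, linear (f^~ v)) -> (forall u, linear (f u)) ->
  sweedler f (tens x y) = f x y.
Proof.
move=> fl fr.
apply: (linear_basisP (f := fun x => sweedler f (tens x y)) (g := f^~ y)) x => // [|p].
  by move=> a u v; rewrite tens_linearl /sweedler linearP.
apply: (linear_basisP (f := fun y => sweedler f (tens (pbase C p) y)) (g := f (pbase C p))) y
  => // [|q].
  by move=> a u v; rewrite tens_linearr /sweedler linearP.
by rewrite -!/(pbase C _) tensUU /sweedler lextU.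
Qed.

Lemma outer_tens a b u v : outer a (tens u v) b = tens (a * u) (v * b).
Proof.
apply: (sweedler_tens (f := fun u v => tens (a * u) (v * b))).
- by move=> w k x y; rewrite mulrDr -pa_scaleAr tens_linearl.
- by move=> w k x y; rewrite mulrDl -pa_scaleAl tens_linearr.
Qed.

Lemma outer_linear a b : linear (fun w => outer a w b).
Proof. by move=> k x y; rewrite /outer /sweedler linearP. Qed.

Lemma ddiff_linear a : linear (ddiff a). Proof. exact: lext_is_linear. Qed.

Lemma ddiff_wpath a v s : walk v s -> ddiff a (wpath C (v, s)) =
  \sum_(0 <= i < size s | nth a s i == a)
    tens (wpath C (v, take i s)) (wpath C (hd a, drop i.+1 s)).
Proof. by move=> h; rewrite (wpathE _ h) /ddiff lextU. Qed.

Lemma ddiff_evert a v : ddiff a (evert C v) = 0.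
Proof. by rewrite ddiff_wpath //= big_geq. Qed.

Lemma ddiff_earr a b : ddiff a (earr C b) =
  if b == a then tens (evert C (tl a)) (evert C (hd a)) else 0.
Proof.
rewrite ddiff_wpath /= ?eqxx // big_mkcond big_nat1 /=.
case: eqP => [->|_]; last by [].
by rewrite /evert.
Qed.

Lemma ddiff_mul_wpath (a : arr Q) v s w t : walk v s -> walk w t ->
  ddiff a (wpath C (v, s) * wpath C (w, t)) =
    outer (wpath C (v, s)) (ddiff a (wpath C (w, t))) 1
    + outer 1 (ddiff a (wpath C (v, s))) (wpath C (w, t)).
Proof.
move=> hs ht; rewrite !ddiff_wpath //.
have outer_sum x y n (P : pred nat) (F : nat -> A2) :
    outer x (\sum_(0 <= i < n | P i) F i) y = \sum_(0 <= i < n | P i) outer x (F i) y.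
  apply: (big_morph (fun w => outer x w y)) => [u u'|].
    by rewrite /outer /sweedler linearD.
  by rewrite /outer /sweedler linear0.
rewrite !outer_sum mul_wpath hs ht /=.
case: eqP => [vw|/eqP vw]; last first.
  have -> : ddiff a (0 : A) = 0 by exact: (linear0 (lext (ddiff_path a))).
  rewrite big_nat_cond big1 => [|i].
    rewrite add0r big_nat_cond big1 // => i.
    move=> /andP[/andP[_ lti] /eqP nia].
    have [wl el wr er] := walk_nth hs lti nia.
    by rewrite outer_tens [X in tens _ X]mul_wpath er (negPf vw) andbF tens0r.
  move=> /andP[/andP[_ lti] /eqP nia].
  by rewrite outer_tens [X in tens X _]mul_wpath (negPf vw) andbF tens0l.
rewrite ddiff_wpath ?walk_cat ?hs ?vw // size_cat.
rewrite (@big_cat_nat _ _ _ (size s)) ?leq_addr //= addrC; congr (_ + _).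
  have nlt i : (i + size s < size s)%N = false by rewrite ltnNge leq_addl.
  rewrite -{1}[size s]add0n big_addn addKn big_nat_cond [RHS]big_nat_cond.
  apply: eq_big => i.
    by rewrite nth_cat nlt addnK.
  move=> /andP[/andP[_ lti]]; rewrite nth_cat nlt addnK /= => /eqP nia.
  have [wl el wr er] := walk_nth ht lti nia.
  rewrite outer_tens mulr1 mul_wpath hs wl vw eqxx /=.
  by rewrite take_cat nlt addnK /= drop_cat -addSn nlt addnK.
rewrite big_nat_cond [RHS]big_nat_cond.
apply: eq_big => i; first by case: ltnP => //= lti; rewrite nth_cat lti.
move=> /andP[/andP[_ lti]]; rewrite nth_cat lti => /eqP nia.
have [wl el wr er] := walk_nth hs lti nia.
rewrite outer_tens mul1r mul_wpath wr ht er vw eqxx /=.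
rewrite take_cat lti drop_cat; case: ltnP => // les.
have -> : i.+1 = size s by apply/eqP; rewrite eqn_leq lti.
by rewrite subnn drop0 drop_size.
Qed.

Lemma ddiff_double_derivation (a : arr Q) : double_derivation (ddiff a).
Proof.
split=> [|x y]; first exact: ddiff_linear.
have mll (z : A) : linear (fun x : A => x * z) by exact: pa_mul_linearl.
have mlr (z : A) : linear (fun x : A => z * x) by exact: pa_mul_linearr.
have oll (w : A2) : linear (fun x : A => outer x w 1).
  move=> k u v; rewrite /outer /sweedler.
  rewrite lext.unlock scaler_sumr -big_split; apply: eq_bigr => p _ /=.
  by rewrite (mll _ k u v) tens_linearl scalerDr !scalerA mulrC.
have olr (w : A2) : linear (fun x : A => outer 1 w x).
  move=> k u v; rewrite /outer /sweedler.
  rewrite lext.unlock scaler_sumr -big_split; apply: eq_bigr => p _ /=.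
  by rewrite (mlr _ k u v) tens_linearr scalerDr !scalerA mulrC.
apply: (linear_basisP (f := fun x : A => ddiff a (x * y))
  (g := fun x : A => outer x (ddiff a y) 1 + outer 1 (ddiff a x) y)) x => [k u v|k u v|p].
- by rewrite (mll _ k u v) ddiff_linear.
- rewrite (oll _ k u v) (ddiff_linear a k u v) outer_linear scalerDr.
  by rewrite !addrA; congr (_ + _); rewrite addrAC.
rewrite -/(pbase C p).
apply: (linear_basisP (f := fun y : A => ddiff a (pbase C p * y))
  (g := fun y : A => outer (pbase C p) (ddiff a y) 1 + outer 1 (ddiff a (pbase C p)) y)) y
  => [k u v|k u v|q].
- by rewrite (mlr _ k u v) ddiff_linear.
- rewrite (olr _ k u v) (ddiff_linear a k u v) outer_linear scalerDr.
  by rewrite !addrA; congr (_ + _); rewrite addrAC.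
rewrite -/(pbase C q) -!wpath_pval.
move: (pvalP p) (pvalP q); case: (pval p) => v s; case: (pval q) => w t.
exact: ddiff_mul_wpath.
Qed.

End DoubleBrackets.

Section LinearBrackets.
Variables (C : fieldType) (Q : quiver).
Local Notation A := (pathalg C Q).
Local Notation A2 := (tensor2 C Q).

(* [inl a] is the arrow a and [inr a] is the reversed arrow a^*. *)
Definition dquiver : quiver :=
  @Quiver (vert Q) (arr Q + arr Q)%type
    (fun x => match x with inl a => tl a | inr a => hd a end)
    (fun x => match x with inl a => hd a | inr a => tl a end).

Local Notation D := (pathalg C dquiver).

Definition star (x : arr dquiver) : bool := if x is inr _ then true else false.

Definition pdeg (p : qpath dquiver) : nat :=
  count star (pseq p).

Definition scommutator : D -> D -> D := lext2 (fun p q =>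
  pbase C p * pbase C q - (-1) ^+ (pdeg p * pdeg q) *: (pbase C q * pbase C p)).

(* The subgroup generated by the supercommutators is a subspace,
   since [scommutator] is bilinear. *)
Definition scomm_span (x : D) : bool :=
  `[< exists s : seq (D * D)%type, x = \sum_(y <- s) scommutator y.1 y.2 >].

Lemma scomm_span_zmod : zmod_closed scomm_span.
Proof.
split; first by apply/asboolP; exists [::]; rewrite big_nil.
move=> x y /asboolP [s ->] /asboolP [t ->]; apply/asboolP.
exists (s ++ [seq (- z.1, z.2) | z <- t]).
rewrite big_cat big_map /= -sumrN; congr (_ + _).
by apply: eq_bigr => z _; rewrite /scommutator !lext2E linearN.
Qed.

HB.instance Definition _ := GRing.isZmodClosed.Build D scomm_span scomm_span_zmod.

Definition nQ := {quot (GRing.ZmodClosed.clone D scomm_span _)}.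
HB.instance Definition _ := EqQuotient.on nQ.
HB.instance Definition _ := GRing.Zmodule.on nQ.

Definition nQ_monomial (a b c : arr Q) : nQ :=
  \pi_nQ (earr C (inl a : arr dquiver) * earr C (inr b : arr dquiver)
          * earr C (inr c : arr dquiver))%R.

Lemma nQ_monomial_eq0 (a b c : arr Q) : (nQ_monomial a b c == 0) =
  scomm_span (earr C (inl a : arr dquiver) * earr C (inr b : arr dquiver)
          * earr C (inr c : arr dquiver)).
Proof.
rewrite -[RHS]/(_ \in GRing.ZmodClosed.clone D scomm_span _).
rewrite -[in RHS](subr0 (_ * _)) idealrBE.
by congr (_ == _); rewrite piE.
Qed.

(* The supertrace on cyclic words that is dual to a d/db d/dc. *)
Definition rot_weight (a b c : arr Q) (s : seq (arr dquiver)) : C^o :=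
  match s with
  | [:: inl x; inr y; inr z] => ([&& x == a, y == b & z == c])%:R
  | [:: inr y; inr z; inl x] => ([&& x == a, y == b & z == c])%:R
  | [:: inr z; inl x; inr y] => - ([&& x == a, y == b & z == c])%:R
  | _ => 0
  end.

Lemma rot_weight_cat (a b c : arr Q) (v w : vert dquiver) t u :
    hd a = hd b -> tl b = hd c -> tl c = tl a -> walk v t -> walk w u ->
  (if wend v t == w then rot_weight a b c (t ++ u) else 0) =
  (-1) ^+ (count star t * count star u)
    * (if wend w u == v then rot_weight a b c (u ++ t) else 0).
Proof.
move=> ab bc ca.
have rs s : size s != 3 -> rot_weight a b c s = 0.
  by case: s => [|[?|?] [|[?|?] [|[?|?] []]]].
have [s3|s3] := eqVneq (size (t ++ u)) 3; last first.
  by rewrite !rs ?if_same ?mulr0 // size_cat addnC -size_cat.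
case: t u s3 => [|x [|y [|z [|? ?]]]] [|x' [|y' [|z' [|? ?]]]] //= _;
  rewrite ?andbT /wend /=.
all: repeat match goal with x : Finite.sort (arr dquiver) |- _ => case: x => x end.
all: rewrite /= ?if_same ?mulr0 ?muln0 ?mul0n ?mul1n ?expr0 ?expr1 ?mul1r //.
all: move=> Ht Hu; case: and3P => [[/eqP ? /eqP ? /eqP ?]|_]; subst;
  rewrite ?if_same ?oppr0 ?mulr0 //.
all: move: Ht Hu; rewrite ?andbT; repeat (move=> /andP[] || move=> /eqP ? || move=> _).
all: subst; rewrite ?(eqxx, mulN1r, opprK, expr0, mul1r) //=.
all: rewrite ?ab ?bc ?ca ?eqxx ?if_same ?oppr0 ?opprK //.
all: by rewrite eq_sym.
Qed.

Lemma nQ_monomial_neq0 (a b c : arr Q) : (nQ_monomial a b c != 0) =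
  [&& hd a == hd b, tl b == hd c & tl c == tl a].
Proof.
have prodE : earr C (inl a : arr dquiver) * earr C (inr b : arr dquiver)
          * earr C (inr c : arr dquiver) =
    if (hd a == hd b) && (tl b == hd c) then
      wpath (Q := dquiver) C (tl a, [:: inl a; inr b; inr c] : seq (arr dquiver)) else 0.
  rewrite mul_wpath /= !eqxx /= /wend /=.
  case: (eqVneq (hd a)) => [e|ne] /=; last exact: pa_mul0l.
  by rewrite mul_wpath /= !eqxx /= e eqxx /wend /=.
rewrite nQ_monomial_eq0 prodE.
have span0 : scomm_span (0 : D) by exact: scomm_span_zmod.1.
have [ab|] /= := eqVneq (hd a) (hd b); last by rewrite span0.
have [bc|] /= := eqVneq (tl b) (hd c); last by rewrite span0.
set s := [:: _; _; _]; have ws : walk (Q := dquiver) (tl a) s.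
  by rewrite /= !eqxx ab bc !eqxx.
have [ca|nca] := eqVneq (tl c) (tl a); last first.
  apply/negbF/asboolP; exists [:: (evert C (tl a : vert dquiver), wpath (Q := dquiver) C (tl a, s))].
  have we : walk (Q := dquiver) (tl a) [::] by [].
  rewrite big_seq1 /= /scommutator /evert (wpathE _ ws) (wpathE _ we) lext2UU.
  rewrite -!(wpathE C) !mul_wpath ws /= /wend /= eqxx (negPf nca).
  by rewrite scaler0 subr0.
apply/negP => /asboolP [l e].
pose f := lext (fun p : qpath dquiver => rot_weight a b c (pseq p)) : D -> C^o.
have fl : linear f by exact: lext_is_linear.
have f0 : f 0 = 0 by exact: (linear0 (lext _)).
have fw v t : f (wpath C (v, t)) = if walk v t then rot_weight a b c t else 0.
  by case: ifPn => h; [rewrite (wpathE _ h) /f lextU | rewrite (wpath0 _ h)].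
have : f (wpath (Q := dquiver) C (tl a, s)) = 0.
  rewrite e; elim: l {e} => [|[x y] l IH]; first by rewrite big_nil.
  rewrite big_cons -[scommutator _ _]scale1r fl IH addr0 scale1r /=.
  apply: (linear_basisP (f := fun x => f (scommutator x y)) (g := fun=> 0)) x
    => [k u v|k u v|p]; last 1 first.
  - apply: (linear_basisP (f := fun y => f (scommutator (pbase C p) y)) (g := fun=> 0)) y
      => [k u v|k u v|q]; last 1 first.
    + rewrite -/(pbase C q) /scommutator lext2UU /pdeg -!wpath_pval /pseq.
      move: (pvalP p) (pvalP q); case: (pval p) => v t; case: (pval q) => w u /= ht hu.
      rewrite !mul_wpath ht hu /=.
      have fB (k : C) X Y : f (X - k *: Y) = f X - k *: f Y.
        by rewrite -scaleNr addrC fl scaleNr addrC.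
      rewrite fB !(fun_if f) f0 !fw !(walk_cat (Q := dquiver)) ht hu /=.
      have := rot_weight_cat ab bc ca ht hu.
      case: (eqVneq (wend v t) w) => [->|_]; case: (eqVneq (wend w u) v) => [->|_];
        rewrite ?ht ?hu => e; apply/eqP; rewrite subr_eq0; exact/eqP.
    + by rewrite /scommutator (lext2_linearr _ _ k u v) fl.
    + by rewrite scaler0 addr0.
  - by rewrite /scommutator (lext2_linearl _ _ k u v) fl.
  - by rewrite scaler0 addr0.
by rewrite fw ws /rot_weight /= !eqxx /= => /eqP; rewrite oner_eq0.
Qed.

(* [sc a b c] is the coefficient of a d/db d/dc. *)
Definition linear_bracket (sc : arr Q -> arr Q -> arr Q -> C) (x y : A) : A2 :=
  \sum_a \sum_b \sum_(c | nQ_monomial a b c != 0)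
    sc a b c *: product_bracket (bimod (earr C a) (ddiff b) 1) (ddiff c) x y.

Definition loop (v : vert Q) := {a : arr Q | (tl a == v) && (hd a == v)}.

Definition loop_mul (sc : arr Q -> arr Q -> arr Q -> C) (v : vert Q) :
    {malg C[loop v]} -> {malg C[loop v]} -> {malg C[loop v]} :=
  lext2 (fun b c : loop v =>
    \sum_(a : loop v) sc (val a) (val b) (val c) *: bvec C a).

End LinearBrackets.

Arguments loop_mul {C Q} sc v.

(* Algebras need not be unital. *)
Definition associative_algebra (C : fieldType) (V : lmodType C)
    (mul : V -> V -> V) : Prop :=
  [/\ forall y, linear (mul^~ y), forall x, linear (mul x) & associative mul].

(* Main.v *)
Require Import Defs.
From HB Require Import structures.
From mathcomp Require Import all_boot all_order all_algebra.
From mathcomp Require Import finmap boolp monalg.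

(** Loops at [v] have both ends at [v], so on arrows [b], [c] that are loops the
    bracket of a linear bivector collapses to
    [{{b, c}} = bc (x) e - e (x) cb], where [e] is the idempotent of [v] and
    [bc] is the product with structure constants [sc]
    ([linear_bracket_loop], extended bilinearly in [linear_bracket_incl]).
    A bracket with [e] vanishes, so plugging this into the double Jacobi
    identity for loops [a], [b], [c] gives, term by term ([jacobi_term]),
    [[
      a(bc) (x) e (x) e - e (x) (bc)a (x) e
      + e (x) b(ca) (x) e - e (x) e (x) (ca)b
      + e (x) e (x) c(ab) - (ab)c (x) e (x) e = 0
    ]]
    The loops and [e] are distinct basis paths; reading off the coefficients of
    the loops in the first tensor factor ([first_loop]) kills the four terms
    that start with [e] and leaves [a(bc) = (ab)c]. *)

Set Implicit Arguments.
Unset Strict Implicit.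
Unset Printing Implicit Defensive.

Import GRing.Theory.
Local Open Scope ring_scope.

(** * Brackets of arrows *)

Section Multilinear.
Variables (C : fieldType) (Q : quiver).
Local Notation A := (pathalg C Q).
Local Notation A2 := (tensor2 C Q).
Local Notation A3 := (tensor3 C Q).

Lemma linear_sumZ (M N : lmodType C) (f : M -> N) (I : finType) (k : I -> C)
    (F : I -> M) :
  linear f -> f (\sum_i k i *: F i) = \sum_i k i *: f (F i).
Proof.
move=> lf; pose B := GRing.isLinear.Build C M N *:%R f lf.
pose f' : {linear M -> N} := HB.pack f B.
rewrite -[f]/(f' : M -> N) linear_sum; apply: eq_bigr => i _.
by rewrite linearZ.
Qed.

Lemma sweedler_linear (V : lmodType C) (f : A -> A -> V) : linear (sweedler f).
Proof. exact: lext_is_linear. Qed.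

Lemma sweedler0 (V : lmodType C) (f : A -> A -> V) : sweedler f 0 = 0.
Proof. by rewrite /sweedler linear0. Qed.

Lemma sweedlerB (V : lmodType C) (f : A -> A -> V) x y :
  sweedler f (x - y) = sweedler f x - sweedler f y.
Proof. by rewrite /sweedler linearB. Qed.

(** Linearity of [sweedler f w] in a parameter on which [f] depends, as needed
    for nested Sweedler expressions. *)
Lemma sweedler_param_linear (U V : lmodType C) (F : U -> A -> A -> V) w :
  (forall p q, linear (fun t => F t p q)) -> linear (fun t => sweedler (F t) w).
Proof.
move=> lF k x y; rewrite /sweedler !lext.unlock scaler_sumr -big_split.
by apply: eq_bigr => p _ /=; rewrite lF scalerDr !scalerA mulrC.
Qed.

Lemma pa_mulr_linear (y : A) : linear (fun x : A => x * y).
Proof. exact: pa_mul_linearl. Qed.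

Lemma pa_mull_linear (x : A) : linear (fun y : A => x * y).
Proof. exact: pa_mul_linearr. Qed.

Lemma tens3_linear1 y z : linear (fun x : A => tens3 x y z : A3).
Proof. by move=> k u v; rewrite /tens3 tens_linearl lext2_linearl. Qed.

Lemma tens3_linear2 x z : linear (fun y : A => tens3 x y z : A3).
Proof. by move=> k u v; rewrite /tens3 tens_linearr lext2_linearl. Qed.

Lemma tens3_linear3 x y : linear (fun z : A => tens3 x y z : A3).
Proof. exact: lext2_linearr. Qed.

Lemma bimod_tens (d : A -> A2) a b c x y :
  d c = tens x y -> bimod a d b c = tens (x * b) (a * y).
Proof.
rewrite /bimod => ->.
apply: (sweedler_tens (f := fun u v => tens (u * b) (a * v))) => w k u v.
  by rewrite pa_mulr_linear tens_linearl.
by rewrite pa_mull_linear tens_linearr.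
Qed.

Lemma bimod0 (d : A -> A2) a b c : d c = 0 -> bimod a d b c = 0.
Proof. by rewrite /bimod => ->; rewrite sweedler0. Qed.

Lemma bimod_linearl (D : A -> A2) b c : linear (fun a : A => bimod a D b c).
Proof.
rewrite /bimod; apply: sweedler_param_linear => p q k u v.
by rewrite pa_mulr_linear tens_linearr.
Qed.

Lemma bimod_linearr (D : A -> A2) a c : linear (fun b : A => bimod a D b c).
Proof.
rewrite /bimod; apply: sweedler_param_linear => p q k u v.
by rewrite pa_mull_linear tens_linearl.
Qed.

Lemma sweedler_bimod (D : A -> A2) x y z :
  sweedler (fun u v => bimod u D v z) (tens x y) = bimod x D y z.
Proof.
apply: (sweedler_tens (f := fun u v => bimod u D v z)) => w.
  exact: bimod_linearl.
exact: bimod_linearr.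
Qed.

Lemma mul_evert w : evert C w * evert C w = evert C w :> A.
Proof. by rewrite mul_wpath /= /wend /= eqxx. Qed.

Lemma mul_evert_earr (a : arr Q) : evert C (tl a) * earr C a = earr C a.
Proof. by rewrite mul_wpath /= /wend /= !eqxx. Qed.

Lemma mul_earr_evert (a : arr Q) : earr C a * evert C (hd a) = earr C a.
Proof. by rewrite mul_wpath /= /wend /= !eqxx. Qed.

(** The closedness hypotheses make the idempotents that appear on either side
    match up: all that remains of [bimod (earr a) (ddiff b) 1] on [b] is
    [e (x) a], so the first term of the product bracket detects
    [(x, y) = (b, c)] and the second one [(x, y) = (c, b)]. *)
Lemma linear_term_earr (a b c x y : arr Q) :
  hd a = hd b -> tl b = hd c -> tl c = tl a ->
  product_bracket (bimod (earr C a) (ddiff b) 1) (ddiff c) (earr C x) (earr C y)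
  = ((x == b) && (y == c))%:R *: tens (earr C a) (evert C (tl b))
    - ((x == c) && (y == b))%:R *: tens (evert C (tl b)) (earr C a).
Proof.
move=> ab bc ca.
have ad z : bimod (earr C a) (ddiff b) 1 (earr C z) =
    if z == b then tens (evert C (tl b)) (earr C a) else 0.
  case: (eqVneq z b) => [->|zb]; last by rewrite bimod0 // ddiff_earr (negPf zb).
  rewrite (bimod_tens _ _ (_ : _ = tens (evert C (tl b)) (evert C (hd b)))).
    by rewrite mulr1 -ab mul_earr_evert.
  by rewrite ddiff_earr eqxx.
have cd z : ddiff c (earr C z) =
    if z == c then tens (evert C (tl a)) (evert C (tl b)) else 0.
  by rewrite ddiff_earr bc ca.
rewrite /product_bracket ad cd; congr (_ - _).
  case: (x == b); last by rewrite sweedler0 scale0r.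
  rewrite sweedler_bimod /=.
  case: (eqVneq y c) => [->|yc]; last by rewrite bimod0 ?scale0r // cd (negPf yc).
  rewrite (bimod_tens _ _ (_ : _ = tens (evert C (tl a)) (evert C (tl b)))).
    by rewrite mul_evert_earr mul_evert scale1r.
  by rewrite cd eqxx.
case: (x == c); last by rewrite sweedler0 scale0r.
rewrite sweedler_bimod /=.
case: (eqVneq y b) => [->|yb]; last by rewrite bimod0 ?scale0r // ad (negPf yb).
rewrite (bimod_tens _ _ (_ : _ = tens (evert C (tl b)) (earr C a))).
  by rewrite mul_evert_earr mul_evert scale1r.
by rewrite ad eqxx.
Qed.

(** Only the double derivation that hits the second argument matters here, and
    every [ddiff] kills the vertex idempotents. *)
Lemma linear_bracket_evert sc (x : A) w : linear_bracket sc x (evert C w) = 0.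
Proof.
rewrite /linear_bracket big1 // => a _; rewrite big1 // => b _.
rewrite big1 // => c _.
have s0 (D : A -> A2) z : D (evert C w) = 0 ->
    sweedler (fun u v => bimod u D v (evert C w)) z = 0.
  move=> D0; rewrite /sweedler lext.unlock big1 // => p _.
  by rewrite bimod0 ?scaler0.
by rewrite /product_bracket !s0 ?subr0 ?scaler0 // ?bimod0 ?ddiff_evert.
Qed.

End Multilinear.

(** * The bracket on loops and its Jacobi identity *)

Section Loops.
Variables (C : fieldType) (Q : quiver) (sc : arr Q -> arr Q -> arr Q -> C).
Variable v : vert Q.
Local Notation A := (pathalg C Q).
Local Notation A2 := (tensor2 C Q).
Local Notation A3 := (tensor3 C Q).
Local Notation V := {malg C[loop v]}.
Local Notation e := (evert C v).

Definition loop_incl : V -> A := lext (fun l => earr C (val l)).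

Lemma loop_inclU l : loop_incl (bvec C l) = earr C (val l).
Proof. exact: lextU. Qed.

Lemma loop_incl_linear : linear loop_incl. Proof. exact: lext_is_linear. Qed.

Lemma loop_mul_linearl y : linear (loop_mul sc v ^~ y).
Proof. exact: lext2_linearl. Qed.

Lemma loop_mul_linearr x : linear (loop_mul sc v x).
Proof. exact: lext2_linearr. Qed.

Lemma tl_loop (l : loop v) : tl (val l) = v.
Proof. by case/andP: (valP l) => /eqP. Qed.

Lemma hd_loop (l : loop v) : hd (val l) = v.
Proof. by case/andP: (valP l) => _ /eqP. Qed.

Lemma loop_incl_mulUU (b c : loop v) :
  loop_incl (loop_mul sc v (bvec C b) (bvec C c)) =
  \sum_(a : loop v) sc (val a) (val b) (val c) *: earr C (val a).
Proof.
rewrite /loop_mul lext2UU (linear_sumZ _ _ loop_incl_linear).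
by apply: eq_bigr => a _; rewrite loop_inclU.
Qed.

Lemma sum_loop (M : zmodType) (F : arr Q -> M) :
  \sum_(a | (tl a == v) && (hd a == v)) F a = \sum_(l : loop v) F (val l).
Proof. exact: (big_sub [pred a : arr Q | (tl a == v) && (hd a == v)]). Qed.

Lemma sum_delta2 (M : lmodType C) (I : finType) (i0 j0 : I)
    (F : I -> I -> M) :
  \sum_i \sum_j ((i0 == i) && (j0 == j))%:R *: F i j = F i0 j0.
Proof.
rewrite (bigD1 i0) //= (bigD1 j0) //= !eqxx scale1r.
rewrite !big1 ?addr0 // => [i ne|j ne]; last first.
  by rewrite [j0 == j]eq_sym (negPf ne) andbF scale0r.
by rewrite big1 // => j _; rewrite [i0 == i]eq_sym (negPf ne) scale0r.
Qed.

Lemma scalerB_comm (M : lmodType C) (k l m : C) (x y : M) :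
  k *: (l *: x - m *: y) = l *: (k *: x) - m *: (k *: y).
Proof. by rewrite scalerBr !scalerA ![k * _]mulrC. Qed.

(** Closedness of [a b^* c^*] for loops [b], [c] at [v] forces [a] to be a loop
    at [v] as well, so the sum over all arrows reduces to one over loops. *)
Lemma linear_bracket_loop (b c : loop v) :
  linear_bracket sc (earr C (val b)) (earr C (val c)) =
  \sum_(a : loop v) sc (val a) (val b) (val c) *: tens (earr C (val a)) e
  - \sum_(a : loop v) sc (val a) (val c) (val b) *: tens e (earr C (val a)).
Proof.
pose P (a x y : arr Q) := [&& hd a == hd x, tl x == hd y & tl y == tl a].
pose F1 a x y : A2 :=
  if P a x y then sc a x y *: tens (earr C a) (evert C (tl x)) else 0.
pose F2 a x y : A2 :=
  if P a x y then sc a x y *: tens (evert C (tl x)) (earr C a) else 0.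
have Ploop a (x y : loop v) : P a (val x) (val y) = (tl a == v) && (hd a == v).
  by rewrite /P !tl_loop !hd_loop eqxx andbC [v == _]eq_sym.
have term a : \sum_x \sum_(y | nQ_monomial C a x y != 0) sc a x y *:
    product_bracket (bimod (earr C a) (ddiff x) 1) (ddiff y)
      (earr C (val b)) (earr C (val c))
    = F1 a (val b) (val c) - F2 a (val c) (val b).
  rewrite -(sum_delta2 (val b) (val c) (F1 a)) -(sum_delta2 (val c) (val b) (F2 a)).
  rewrite -sumrB; apply: eq_bigr => x _; rewrite -sumrB big_mkcond.
  apply: eq_bigr => y _; rewrite nQ_monomial_neq0 -/(P a x y) /F1 /F2.
  case PE: (P a x y); last by rewrite !scaler0 subr0.
  case/and3P: PE => /eqP ax /eqP xy /eqP ya.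
  rewrite (linear_term_earr _ _ _ ax xy ya) [(val c == x) && _]andbC.
  move: (tens _ _) (tens _ _) => u w.
  exact: scalerB_comm.
rewrite /linear_bracket (eq_bigr _ (fun a _ => term a)) sumrB.
congr (_ - _).
  apply: etrans (sum_loop (fun a => sc a (val b) (val c) *: tens (earr C a) e)).
  by rewrite [RHS]big_mkcond; apply: eq_bigr => a _; rewrite /F1 Ploop tl_loop.
apply: etrans (sum_loop (fun a => sc a (val c) (val b) *: tens e (earr C a))).
by rewrite [RHS]big_mkcond; apply: eq_bigr => a _; rewrite /F2 Ploop tl_loop.
Qed.

Hypothesis Plin : double_bracket (linear_bracket sc).

Lemma linear_bracket_incl x y :
  linear_bracket sc (loop_incl x) (loop_incl y) =
  tens (loop_incl (loop_mul sc v x y)) e - tens e (loop_incl (loop_mul sc v y x)).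
Proof.
have [brl brd _] := Plin; have brr z := (brd z).1.
have sumZ (k : C) (N : lmodType C) (a b a' b' : N) :
    (k *: a + a') - (k *: b + b') = k *: (a - b) + (a' - b').
  by rewrite scalerBr opprD addrACA.
apply: (linear_basisP
  (f := fun x => linear_bracket sc (loop_incl x) (loop_incl y))
  (g := fun x => tens (loop_incl (loop_mul sc v x y)) e
               - tens e (loop_incl (loop_mul sc v y x)))) x => [k u w|k u w|b].
- by rewrite loop_incl_linear brl.
- rewrite loop_mul_linearl loop_mul_linearr !loop_incl_linear.
  by rewrite tens_linearl tens_linearr sumZ.
apply: (linear_basisP
  (f := fun y => linear_bracket sc (loop_incl (bvec C b)) (loop_incl y))
  (g := fun y => tens (loop_incl (loop_mul sc v (bvec C b) y)) e
               - tens e (loop_incl (loop_mul sc v y (bvec C b))))) y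
  => [k u w|k u w|c].
- by rewrite loop_incl_linear brr.
- rewrite loop_mul_linearl loop_mul_linearr !loop_incl_linear.
  by rewrite tens_linearl tens_linearr sumZ.
rewrite !loop_incl_mulUU !loop_inclU linear_bracket_loop.
by rewrite (linear_sumZ _ _ (tens_linearl e)) (linear_sumZ _ _ (tens_linearr e)).
Qed.

(** The three summands of the double Jacobi identity differ only by a cyclic
    permutation of the arguments and of the tensor factors, so one computation
    with a trilinear [G], which places the factors, serves for all of them. *)
Lemma jacobi_term (G : A -> A -> A -> A3) (x y z : V) :
  (forall q r, linear (fun p => G p q r)) ->
  (forall p r, linear (fun q => G p q r)) ->
  (forall p q, linear (fun r => G p q r)) ->
  sweedler (fun p r => sweedler (fun q s => G q s r)
      (linear_bracket sc (loop_incl x) p))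
    (linear_bracket sc (loop_incl y) (loop_incl z))
  = G (loop_incl (loop_mul sc v x (loop_mul sc v y z))) e e
    - G e (loop_incl (loop_mul sc v (loop_mul sc v y z) x)) e.
Proof.
move=> G1 G2 G3; have [_ brd _] := Plin; have brr u := (brd u).1.
have outer_lin r : linear (fun p => sweedler (fun q s => G q s r)
    (linear_bracket sc (loop_incl x) p)).
  by move=> k u w; rewrite brr sweedler_linear.
have outer_param p : linear (fun r => sweedler (fun q s => G q s r)
    (linear_bracket sc (loop_incl x) p)).
  by apply: sweedler_param_linear => q s; exact: G3.
rewrite linear_bracket_incl sweedlerB.
rewrite !(sweedler_tens _ _ outer_lin outer_param).
rewrite linear_bracket_evert sweedler0 subr0 linear_bracket_incl sweedlerB.
by rewrite !sweedler_tens.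
Qed.

(** Extended linearly, this is a left inverse of [loop_incl]. *)
Definition loop_coord (p : qpath Q) : V :=
  if pseq p is [:: a] then if insub a is Some l then bvec C l else 0 else 0.

(** Any functional on the last two factors that is 1 on [e (x) e] would do; the
    sum of the coefficients is the simplest. *)
Definition first_loop : A3 -> V := lext (fun pqr => loop_coord pqr.1.1).

Lemma first_loop_tens3 (x : A) u w :
  first_loop (tens3 x (evert C u) (evert C w)) = lext loop_coord x.
Proof.
apply: (linear_basisP (f := fun x => first_loop (tens3 x (evert C u) (evert C w)))
  (g := lext loop_coord)) x => [k p q||p].
- by rewrite tens3_linear1 /first_loop linearP.
- exact: lext_is_linear.
have we t : walk (Q := Q) t [::] by [].
rewrite /first_loop /tens3 /evert !(wpathE C (we _)) tensUU lext2UU !lextU.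
by [].
Qed.

Lemma first_loop_evert w (y z : A) : first_loop (tens3 (evert C w) y z) = 0.
Proof.
have we t : walk (Q := Q) t [::] by [].
apply: (linear_basisP (f := fun y => first_loop (tens3 (evert C w) y z))
  (g := fun=> 0)) y => [k p q|k p q|p].
- by rewrite tens3_linear2 /first_loop linearP.
- by rewrite scaler0 addr0.
apply: (linear_basisP (f := fun z => first_loop (tens3 (evert C w) (bvec C p) z))
  (g := fun=> 0)) z => [k q r|k q r|q].
- by rewrite tens3_linear3 /first_loop linearP.
- by rewrite scaler0 addr0.
by rewrite /first_loop /tens3 /evert (wpathE C (we _)) tensUU lext2UU lextU.
Qed.

Lemma loop_coord_incl (x : V) : lext loop_coord (loop_incl x) = x.
Proof.
apply: (linear_basisP (f := fun x => lext loop_coord (loop_incl x)) (g := id)) x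
  => [k p q||l] //.
  by rewrite loop_incl_linear linearP.
have wl : walk (tl (val l)) [:: val l] by rewrite /= eqxx.
by rewrite loop_inclU /earr (wpathE C wl) lextU /loop_coord /= valK.
Qed.

Lemma loop_mulA : double_jacobi (linear_bracket sc) -> associative (loop_mul sc v).
Proof.
move=> J x y z.
have T1 := jacobi_term (G := fun u w r => tens3 u w r) x y z
  (fun q r => @tens3_linear1 C Q q r) (fun p r => @tens3_linear2 C Q p r)
  (fun p q => @tens3_linear3 C Q p q).
have T2 := jacobi_term (G := fun u w r => tens3 r u w) y z x
  (fun q r => @tens3_linear2 C Q r q) (fun p r => @tens3_linear3 C Q r p)
  (fun p q => @tens3_linear1 C Q p q).
have T3 := jacobi_term (G := fun u w r => tens3 w r u) z x y
  (fun q r => @tens3_linear3 C Q q r) (fun p r => @tens3_linear1 C Q r p)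
  (fun p q => @tens3_linear2 C Q q p).
have := etrans (esym (congr2 +%R (congr2 +%R T1 T2) T3))
  (J (loop_incl x) (loop_incl y) (loop_incl z)).
move=> /(congr1 first_loop).
have fD u w : first_loop (u + w) = first_loop u + first_loop w by exact: linearD.
have fN u : first_loop (- u) = - first_loop u by exact: linearN.
have f0 : first_loop 0 = 0 by exact: linear0.
rewrite !fD !fN f0 !first_loop_evert !first_loop_tens3 !loop_coord_incl.
by rewrite oppr0 !addr0 add0r => /eqP; rewrite subr_eq0 => /eqP.
Qed.

End Loops.

Theorem corollary9 (C : closedFieldType) (charC : [pchar C] =i pred0)
    (Q : quiver) (sc : arr Q -> arr Q -> arr Q -> C) (v : vert Q)
    (Plin_poisson : double_poisson (linear_bracket sc)) :
  associative_algebra (loop_mul sc v).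
Proof.
have [br jac] := Plin_poisson.
by split; [exact: loop_mul_linearl | exact: loop_mul_linearr | exact: loop_mulA].
Qed.
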